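(* Let $G:[c,d]\to\mathbb{R}$ be a fixed Riemann integrable function on $[c,d]$. Then the following are equivalent: (i) for every Riemann integrable function $f:[a,b]\to[c,d]$, the composition $G\circ f$ is Riemann integrable on $[a,b]$; (ii) $G$ is continuous on $[c,d]$.
   Context: Here $a<b$ and $c<d$ are fixed real numbers. *)

(* Defs.v *)
From Stdlib Require Import Reals.
From Coquelicot Require Import Coquelicot.

(* A function on a closed interval [u, v] is represented by a function R -> R
   of which only the values on [u, v] matter: for u < v, [ex_RInt h u v]
   samples h only at tags in [u, v], and [continuous_on D h] is continuity
   relative to D (one-sided at the endpoints when D = [u, v]). *)
Definition Icc (u v x : R) : Prop := (u <= x <= v)%R.

(* Main.v *)
Require Import Defs.
From Stdlib Require Import Reals.
From Coquelicot Require Import Coquelicot.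
From Stdlib Require Import Lra Lia List Classical IndefiniteDescription.
From Stdlib Require Import ZArith Cantor.
Open Scope R_scope.

(** If [G] is continuous on the compact interval, it extends to a bounded uniformly
    continuous function [g] on the line. Such a function is Lipschitz up to an
    arbitrarily small error: for every [eta > 0] some [K] satisfies
    [|g x - g y| <= eta + K |x - y|] ([continuous_on_clamp_almost_lipschitz]).
    Riemann integrability of [f] means that step functions [phi] approximate it
    within step functions [psi] of small integral. Then [g o phi] is a step function
    approximating [g o f] within [eta + K psi], which again has small integral, so
    [g o f] is integrable ([ex_RInt_comp_almost_lipschitz]).

    Conversely, let [G] be discontinuous at [x0], with points [xs n] tending to [x0]
    such that [|G (xs n) - G x0| >= eps]. A variant of Thomae's function then
    breaks integrability: enumerate the dyadic numbers as [q 0, q 1, ...], and let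
    [f] take a value [xs n] with [q n = t] at each dyadic [t] and the value [x0]
    elsewhere. Only finitely many [xs n] are far from [x0], so [f] is a uniform limit
    of functions that are constant up to finitely many points, hence integrable
    ([ex_RInt_thomae]). But [|G o f - G x0|] is at least [eps] at the dyadic numbers
    and vanishes at all others. Both sets are dense, and a Riemann integral can be
    computed from samples in any dense set ([RInt_ge_of_dense]), so [G o f] is not
    integrable ([not_ex_RInt_comp_thomae]). *)

(** * Composing a Riemann integrable function with a continuous one *)

Lemma IsStepFun_comp (g phi : R -> R) (a b : R) :
  IsStepFun phi a b -> IsStepFun (fun x => g (phi x)) a b.
Proof.
  intros [l [lf [Hord [Hfirst [Hlast [Hlen Hval]]]]]].
  exists l; exists (map g lf).
  repeat split; try assumption.
  - now rewrite length_map.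
  - intros i Hi x Hx.
    rewrite (Hval i Hi x Hx).
    assert (Hlt : (i < length lf)%nat) by (rewrite Hlen in Hi; exact Hi).
    clear - Hlt; revert i Hlt.
    induction lf as [|y lf IH]; intros [|i] Hlt; simpl in *; try lia; auto.
    apply IH; lia.
Qed.

(** For points at distance at least the modulus of continuity [delta], the bound
    [W] on the oscillation of [g] is a Lipschitz bound with constant [W / delta];
    closer points have values within [eta] of each other. *)
Lemma continuous_almost_lipschitz (g : R -> R) (W eta : R) :
  (forall x y, Rabs (g x - g y) <= W) -> 0 < eta ->
  (exists delta, 0 < delta /\
     forall x y, Rabs (x - y) < delta -> Rabs (g x - g y) < eta) ->
  exists K, 0 <= K /\ forall x y, Rabs (g x - g y) <= eta + K * Rabs (x - y).
Proof.
  intros HW Heta [delta [Hdelta Hunif]].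
  assert (W0 : 0 <= W) by (apply Rle_trans with (2 := HW 0 0); apply Rabs_pos).
  assert (K0 : 0 <= W / delta)
    by (apply Rmult_le_pos; [lra | apply Rlt_le, Rinv_0_lt_compat; lra]).
  exists (W / delta); split; [exact K0|]; intros x y.
  destruct (Rlt_or_le (Rabs (x - y)) delta) as [Hlt|Hge].
  - assert (0 <= W / delta * Rabs (x - y))
      by (apply Rmult_le_pos; [exact K0 | apply Rabs_pos]).
    specialize (Hunif x y Hlt); lra.
  - assert (W / delta * delta <= W / delta * Rabs (x - y))
      by (apply Rmult_le_compat_l; assumption).
    replace (W / delta * delta) with W in * by (field; lra).
    specialize (HW x y); lra.
Qed.

(** If a step function [phi] approximates [f] within [psi], then the step function
    [g o phi] approximates [g o f] within [eta + K psi], whose integral is small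
    once [eta] is chosen first and then [psi] according to [K]. *)
Lemma ex_RInt_comp_almost_lipschitz (g f : R -> R) (a b : R) :
  a < b ->
  (forall eta, 0 < eta -> exists K, 0 <= K /\
     forall x y, Rabs (g x - g y) <= eta + K * Rabs (x - y)) ->
  ex_RInt f a b -> ex_RInt (fun x => g (f x)) a b.
Proof.
  intros hab Hg Hf.
  apply ex_RInt_Reals_1; intro eps.
  pose proof (cond_pos eps) as Heps.
  set (eta := eps / 2 / (b - a)).
  assert (Heta : 0 < eta) by (unfold eta; repeat apply Rdiv_lt_0_compat; lra).
  destruct (constructive_indefinite_description _ (Hg eta Heta))
    as [K [HK Hgfphi]].
  assert (He : 0 < eps / 2 / (K + 1))
    by (repeat apply Rdiv_lt_0_compat; lra).
  destruct (ex_RInt_Reals_0 f a b Hf (mkposreal _ He))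
    as [phi [psi [Happrox Hpsi]]]; simpl in Hpsi.
  exists (mkStepFun (IsStepFun_comp g phi a b (pre phi))).
  exists (mkStepFun (StepFun_P28 K (mkStepFun (StepFun_P4 a b eta)) psi)).
  split.
  - intros t Ht; simpl; unfold fct_cte.
    apply Rle_trans with (1 := Hgfphi (f t) (phi t)).
    apply Rplus_le_compat_l, Rmult_le_compat_l; auto.
  - rewrite StepFun_P30, StepFun_P18.
    apply Rle_lt_trans with (1 := Rabs_triang _ _).
    replace (eta * (b - a)) with (eps / 2) by (unfold eta; field; lra).
    rewrite Rabs_mult, (Rabs_pos_eq K), (Rabs_pos_eq (eps / 2)) by lra.
    set (I := Rabs (RiemannInt_SF psi)) in *.
    assert (0 <= I) by apply Rabs_pos.
    assert ((K + 1) * I < (K + 1) * (eps / 2 / (K + 1)))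
      by (apply Rmult_lt_compat_l; lra).
    replace ((K + 1) * (eps / 2 / (K + 1))) with (eps / 2) in * by (field; lra).
    lra.
Qed.

Definition clamp (c d x : R) : R := Rmax c (Rmin x d).

Lemma clamp_in (c d x : R) : c <= d -> Icc c d (clamp c d x).
Proof.
  intro H; unfold Icc, clamp, Rmax, Rmin; repeat destruct Rle_dec; lra.
Qed.

Lemma clamp_id (c d x : R) : Icc c d x -> clamp c d x = x.
Proof.
  unfold Icc, clamp, Rmax, Rmin; intro H; repeat destruct Rle_dec; lra.
Qed.

Lemma clamp_lipschitz (c d x y : R) :
  c <= d -> Rabs (clamp c d x - clamp c d y) <= Rabs (x - y).
Proof.
  intro H; unfold clamp, Rmax, Rmin.
  repeat destruct Rle_dec; unfold Rabs; repeat destruct Rcase_abs; lra.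
Qed.

Lemma continuity_pt_clamp_ext (G : R -> R) (c d x : R) :
  c <= d -> continuous_on (Icc c d) G ->
  continuity_pt (fun t => G (clamp c d t)) x.
Proof.
  intros Hcd HG.
  apply continuity_pt_filterlim, filterlim_locally; intro eps.
  destruct (proj1 (filterlim_locally _ _)
              (HG (clamp c d x) (clamp_in c d x Hcd)) eps) as [delta Hdelta].
  exists delta; intros y Hy.
  apply Hdelta; [|now apply clamp_in].
  apply Rle_lt_trans with (1 := clamp_lipschitz c d y x Hcd), Hy.
Qed.

(** The extension of [G] by its end values is continuous on the whole line, and
    its variation is already attained on the compact interval from [c] to [d], where Heine's theorem
    and the extreme value theorem apply. *)
Lemma continuous_on_clamp_almost_lipschitz (G : R -> R) (c d : R) :
  c <= d -> continuous_on (Icc c d) G ->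
  forall eta, 0 < eta -> exists K, 0 <= K /\ forall x y,
    Rabs (G (clamp c d x) - G (clamp c d y)) <= eta + K * Rabs (x - y).
Proof.
  intros Hcd HG eta Heta.
  set (g := fun t => G (clamp c d t)).
  assert (Hg : forall x, c <= x <= d -> continuity_pt g x)
    by (intros; now apply continuity_pt_clamp_ext).
  assert (Hgc : forall x, g (clamp c d x) = g x)
    by (intro x; unfold g; now rewrite (clamp_id c d (clamp c d x))
          by now apply clamp_in).
  destruct (continuity_ab_maj g c d Hcd Hg) as [M [HM _]].
  destruct (continuity_ab_min g c d Hcd Hg) as [m [Hm _]].
  apply (continuous_almost_lipschitz g (g M - g m)); [|exact Heta|].
  - intros x y; rewrite <- (Hgc x), <- (Hgc y).
    pose proof (clamp_in c d x Hcd) as Hx; pose proof (clamp_in c d y Hcd) as Hy.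
    pose proof (HM _ Hx); pose proof (Hm _ Hx).
    pose proof (HM _ Hy); pose proof (Hm _ Hy).
    apply Rabs_le; lra.
  - destruct (Heine_cor2 Hg (mkposreal eta Heta)) as [delta Hdelta].
    exists delta; split; [apply cond_pos|]; intros x y Hxy.
    rewrite <- (Hgc x), <- (Hgc y).
    apply Hdelta; [now apply clamp_in | now apply clamp_in |].
    apply Rle_lt_trans with (2 := Hxy); now apply clamp_lipschitz.
Qed.

(** * Integrals and dense sets of sample points *)

Definition dense (P : R -> Prop) : Prop :=
  forall u v, u < v -> exists t, u < t < v /\ P t.

Lemma Riemann_sum_f2_ge (k : R -> R) (tag : R -> R -> R) (m : R) (h : R)
  (s : list R) :
  sorted Rle (h :: s) ->
  (forall x y, x <= y -> (y - x) * m <= (y - x) * k (tag x y)) ->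
  (seq.last h s - h) * m <= Riemann_sum k (SF_seq_f2 tag (h :: s)).
Proof.
  intros Hsort Htag; revert h Hsort.
  induction s as [|y s IH]; intros h Hsort.
  - unfold Riemann_sum; simpl; unfold zero; simpl; lra.
  - destruct Hsort as [Hhy Hsort].
    rewrite SF_cons_f2 by (simpl; lia).
    rewrite Riemann_sum_cons.
    specialize (IH y Hsort); specialize (Htag h y Hhy).
    change (SF_h (SF_seq_f2 tag (y :: s))) with y.
    simpl in *; unfold plus, scal; simpl; unfold mult; simpl.
    lra.
Qed.

(** The integral is a limit of Riemann sums, whose tags may be placed anywhere in
    their cells, hence at points of [P]. *)
Lemma RInt_ge_of_dense (k : R -> R) (P : R -> Prop) (m a b : R) :
  a < b -> dense P -> (forall x, P x -> m <= k x) ->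
  ex_RInt k a b -> m * (b - a) <= RInt k a b.
Proof.
  intros hab HP Hk Hex.
  assert (Htag : forall xy : R * R, exists t,
    (fst xy <= snd xy -> fst xy <= t <= snd xy) /\ (fst xy < snd xy -> P t)).
  { intros [x y]; simpl.
    destruct (Rlt_or_le x y) as [Hxy|Hxy].
    - destruct (HP x y Hxy) as [t [Ht HPt]]; exists t; split; auto; lra.
    - exists x; split; intros; lra. }
  destruct (functional_choice _ Htag) as [tag0 Htag0].
  set (tag := fun x y => tag0 (x, y)).
  assert (Hin : forall x y, x <= y -> x <= tag x y <= y)
    by (intros x y; exact (proj1 (Htag0 (x, y)))).
  assert (Hge : forall x y, x <= y -> (y - x) * m <= (y - x) * k (tag x y)).
  { intros x y [Hxy| ->]; [|lra].
    apply Rmult_le_compat_l; [lra|].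
    apply Hk, (proj2 (Htag0 (x, y))), Hxy. }
  apply le_epsilon; intros eps Heps.
  pose proof (RInt_correct k a b Hex) as Hint.
  destruct (proj1 (filterlim_locally _ _) Hint (mkposreal eps Heps))
    as [delta Hdelta].
  destruct (seq_step_unif_part_ex a b delta) as [N HN].
  destruct (Riemann_fine_unif_part tag a b N Hin (Rlt_le _ _ hab)) as [_ Hfine].
  assert (Hlx : SF_lx (SF_seq_f2 tag (unif_part a b N)) = unif_part a b N)
    by (apply SF_lx_f2; unfold unif_part; rewrite seq.size_mkseq; lia).
  specialize (Hdelta (SF_seq_f2 tag (unif_part a b N))).
  rewrite Rmin_left, Rmax_right in Hdelta by lra.
  assert (Hball : Rabs (Riemann_sum k (SF_seq_f2 tag (unif_part a b N))
                        - RInt k a b) < eps).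
  { rewrite <- (Rmult_1_l (Riemann_sum _ _)).
    rewrite <- (sign_eq_1 (b - a)) by lra.
    apply Hdelta; [|exact Hfine].
    now rewrite Hlx. }
  destruct Hfine as [_ [Hh Hl]].
  pose proof (unif_part_sort a b N (Rlt_le _ _ hab)) as Hsort.
  rewrite Hlx, Hh in Hl.
  change (SF_h (SF_seq_f2 tag (unif_part a b N)))
    with (seq.head 0 (unif_part a b N)) in Hh.
  destruct (unif_part a b N) as [|h s]; [simpl in Hl; lra|].
  simpl in Hh, Hl; subst h.
  pose proof (Riemann_sum_f2_ge k tag m a s Hsort Hge) as Hsum.
  rewrite Hl in Hsum.
  apply Rabs_lt_between in Hball; lra.
Qed.

(** * A Thomae-type function with prescribed values on a countable dense set *)

Definition enum_dyadic (n : nat) : R :=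
  let (i, r) := of_nat n in
  let (j, k) := of_nat r in (INR i - INR j) / 2 ^ k.

Lemma enum_dyadic_spec (t : R) :
  (exists n, enum_dyadic n = t) <-> exists (z : Z) (k : nat), t = IZR z / 2 ^ k.
Proof.
  split.
  - intros [n <-]; unfold enum_dyadic.
    destruct (of_nat n) as [i r]; destruct (of_nat r) as [j k].
    exists (Z.of_nat i - Z.of_nat j)%Z, k.
    now rewrite minus_IZR, <- !INR_IZR_INZ.
  - intros [z [k ->]].
    exists (to_nat (Z.to_nat z, to_nat (Z.to_nat (- z), k))).
    unfold enum_dyadic; rewrite !cancel_of_to, !INR_IZR_INZ.
    rewrite <- minus_IZR.
    replace (Z.of_nat (Z.to_nat z) - Z.of_nat (Z.to_nat (- z)))%Z with z by lia.
    reflexivity.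
Qed.

Lemma dense_dyadic : dense (fun t => exists n, enum_dyadic n = t).
Proof.
  intros u v Huv.
  destruct (pow_lt_1_zero (/ 2)) with (y := v - u) as [k Hk];
    [rewrite Rabs_pos_eq; lra | lra |].
  specialize (Hk k (le_n k)).
  assert (Hpow : 0 < 2 ^ k) by (apply pow_lt; lra).
  rewrite pow_inv, Rabs_pos_eq in Hk by (apply Rlt_le, Rinv_0_lt_compat, Hpow).
  destruct (archimed (u * 2 ^ k)) as [Hup Hup1].
  set (z := up (u * 2 ^ k)) in *.
  exists (IZR z / 2 ^ k); split; [split|].
  - apply Rmult_lt_reg_r with (2 ^ k); [lra|].
    replace (IZR z / 2 ^ k * 2 ^ k) with (IZR z) by (field; lra); lra.
  - apply Rmult_lt_reg_r with (2 ^ k); [lra|].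
    replace (IZR z / 2 ^ k * 2 ^ k) with (IZR z) by (field; lra).
    assert (/ 2 ^ k * 2 ^ k < (v - u) * 2 ^ k)
      by (apply Rmult_lt_compat_r; lra).
    rewrite Rinv_l in * by lra; lra.
  - apply enum_dyadic_spec; now exists z, k.
Qed.

Lemma pow2_not_multiple_of_3 (n : nat) (x : Z) : (2 ^ Z.of_nat n <> 3 * x)%Z.
Proof.
  revert x; induction n as [|n IH]; intros x.
  - change (1 <> 3 * x)%Z; lia.
  - rewrite Nat2Z.inj_succ, Z.pow_succ_r by lia.
    intro H; apply (IH (2 ^ Z.of_nat n - x)%Z); lia.
Qed.

(** The translates by [1 / 3] of the dyadic numbers are dense as well, and none of
    them is dyadic. *)
Lemma dense_not_dyadic : dense (fun t => forall n, enum_dyadic n <> t).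
Proof.
  intros u v Huv.
  destruct (dense_dyadic (u - 1 / 3) (v - 1 / 3)) as [p [Hp Hdy]]; [lra|].
  exists (p + 1 / 3); split; [lra|]; intros n Hn.
  destruct (proj1 (enum_dyadic_spec _) Hdy) as [z [k Hz]].
  destruct (proj1 (enum_dyadic_spec _) (ex_intro _ n Hn)) as [z' [k' Hz']].
  apply (pow2_not_multiple_of_3 (k + k')
           (z' * 2 ^ Z.of_nat k - z * 2 ^ Z.of_nat k')).
  apply eq_IZR.
  rewrite mult_IZR, minus_IZR, !mult_IZR, <- !pow_IZR, pow_add.
  assert (0 < 2 ^ k) by (apply pow_lt; lra).
  assert (0 < 2 ^ k') by (apply pow_lt; lra).
  assert (IZR z = p * 2 ^ k) as -> by (rewrite Hz; field; lra).
  assert (IZR z' = (p + 1 / 3) * 2 ^ k') as -> by (rewrite Hz'; field; lra).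
  field.
Qed.

Lemma ex_RInt_finite_modif (l : list R) (f g : R -> R) (a b : R) :
  a <= b -> (forall x, a < x < b -> ~ In x l -> f x = g x) ->
  ex_RInt f a b -> ex_RInt g a b.
Proof.
  revert a b; induction l as [|p l IH]; intros a b hab Heq Hf.
  - apply ex_RInt_ext with (2 := Hf).
    rewrite Rmin_left, Rmax_right by lra; intros; now apply Heq.
  - destruct (Rlt_or_le a p) as [Hap|Hpa]; [destruct (Rlt_or_le p b) as [Hpb|Hbp]|].
    + apply ex_RInt_Chasles with p.
      * apply IH; [lra | | now apply (@ex_RInt_Chasles_1 R_CompleteNormedModule) with b; [lra|]].
        intros x Hx Hl; apply Heq; [lra|]; intros [|]; [lra | auto].
      * apply IH; [lra | | now apply (@ex_RInt_Chasles_2 R_CompleteNormedModule) with a; [lra|]].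
        intros x Hx Hl; apply Heq; [lra|]; intros [|]; [lra | auto].
    + apply IH; auto; intros x Hx Hl; apply Heq; [lra|]; intros [|]; [lra | auto].
    + apply IH; auto; intros x Hx Hl; apply Heq; [lra|]; intros [|]; [lra | auto].
Qed.

(** Only finitely many terms [xs n] are far from the limit [x0], so [f] is a
    uniform limit of functions that equal [x0] off a finite set. *)
Lemma ex_RInt_thomae (q xs : nat -> R) (x0 : R) (f : R -> R) (a b : R) :
  a <= b -> is_lim_seq xs x0 ->
  (forall t, (exists n, q n = t /\ f t = xs n)
             \/ ((forall n, q n <> t) /\ f t = x0)) ->
  ex_RInt f a b.
Proof.
  intros hab Hlim Hf.
  set (l := fun N => map q (seq 0 N)).
  set (fN := fun (N : nat) t =>
               if in_dec Req_dec_T t (l N) then f t else x0).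
  assert (HfN : forall N, ex_RInt (fN N) a b).
  { intro N.
    apply (ex_RInt_finite_modif (l N) (fun _ => x0)); [lra | | apply ex_RInt_const].
    intros t _ Ht; unfold fN; destruct in_dec; [contradiction | reflexivity]. }
  destruct (filterlim_RInt fN a b Hierarchy.eventually _ f (fun N => RInt (fN N) a b))
    as [I [_ HI]].
  - intro N; apply (@RInt_correct R_CompleteNormedModule), HfN.
  - apply filterlim_locally; intro eps.
    destruct (proj1 (is_lim_seq_Reals _ _) Hlim eps (cond_pos eps)) as [N0 HN0].
    exists N0; intros N HN t.
    change (Rabs (fN N t - f t) < eps).
    unfold fN; destruct in_dec as [_|Hnot].
    + rewrite Rminus_diag, Rabs_R0; apply cond_pos.
    + destruct (Hf t) as [[n [Hqn ->]]|[_ ->]].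
      * rewrite Rabs_minus_sym; apply HN0.
        (* t = q n is not among q 0, .., q (N - 1), so N <= n *)
        destruct (Nat.lt_ge_cases n N) as [Hlt|Hge]; [|lia].
        exfalso; apply Hnot; rewrite <- Hqn.
        apply in_map, in_seq; lia.
      * rewrite Rminus_diag, Rabs_R0; apply cond_pos.
  - now exists I.
Qed.

(** * Discontinuity of the outer function *)

Lemma discontinuity_sequence (D : R -> Prop) (G : R -> R) (x0 : R) :
  ~ filterlim G (within D (locally x0)) (locally (G x0)) ->
  exists (eps : posreal) (xs : nat -> R),
    is_lim_seq xs x0 /\
    forall n, D (xs n) /\ eps <= Rabs (G (xs n) - G x0).
Proof.
  intro Hdisc.
  apply NNPP; intro Hno; apply Hdisc, filterlim_locally; intro eps.
  apply NNPP; intro Hfar; apply Hno; exists eps.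
  assert (Hxs : forall n, exists x,
    Rabs (x - x0) < / INR (S n) /\ D x /\ eps <= Rabs (G x - G x0)).
  { intro n; apply NNPP; intro Hn; apply Hfar.
    assert (Hpos : 0 < / INR (S n))
      by (apply Rinv_0_lt_compat, lt_0_INR; lia).
    exists (mkposreal _ Hpos); intros x Hx HDx.
    apply Rnot_le_lt; intro Hle; apply Hn; exists x; auto. }
  destruct (functional_choice _ Hxs) as [xs Hseq].
  exists xs; split; [|intro n; apply Hseq].
  apply is_lim_seq_Reals; intros e He.
  destruct (archimed_cor1 e He) as [N [HN HN0]].
  exists N; intros n Hn.
  apply Rlt_trans with (1 := proj1 (Hseq n)).
  apply Rle_lt_trans with (2 := HN).
  apply Rinv_le_contravar; [apply lt_0_INR; lia | apply le_INR; lia].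
Qed.

(** For the Thomae function [f], the function [|G o f - G x0|] is at least [eps]
    on a dense set and zero on another one, so its integral would have to be both
    positive and nonpositive. *)
Lemma not_ex_RInt_comp_thomae (q xs : nat -> R) (x0 : R) (f G : R -> R)
  (a b eps : R) :
  a < b -> 0 < eps ->
  dense (fun t => exists n, q n = t) -> dense (fun t => forall n, q n <> t) ->
  (forall n, eps <= Rabs (G (xs n) - G x0)) ->
  (forall t, (exists n, q n = t /\ f t = xs n)
             \/ ((forall n, q n <> t) /\ f t = x0)) ->
  ~ ex_RInt (fun x => G (f x)) a b.
Proof.
  intros hab Heps Hq Hqc Hfar Hf Hex.
  set (k := fun x => Rabs (G (f x) - G x0)).
  assert (Hk : ex_RInt k a b).
  { apply (ex_RInt_norm (fun x => G (f x) - G x0)).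
    apply (ex_RInt_minus (V := R_NormedModule)); [exact Hex | apply ex_RInt_const]. }
  assert (Hlow : eps * (b - a) <= RInt k a b).
  { apply (RInt_ge_of_dense k (fun t => exists n, q n = t)); auto.
    intros t [n Hn]; unfold k.
    destruct (Hf t) as [[i [_ ->]]|[Hnot _]]; [apply Hfar|].
    now elim (Hnot n). }
  assert (Hup : 0 * (b - a) <= RInt (fun x => opp (k x)) a b).
  { apply (RInt_ge_of_dense _ (fun t => forall n, q n <> t)); auto.
    - intros t Ht; unfold k.
      destruct (Hf t) as [[n [Hn _]]|[_ ->]]; [now elim (Ht n)|].
      rewrite Rminus_diag, Rabs_R0; unfold opp; simpl; lra.
    - now apply (ex_RInt_opp (V := R_NormedModule)). }
  rewrite (RInt_opp (V := R_CompleteNormedModule)) in Hup by exact Hk.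
  unfold opp in Hup; simpl in Hup.
  assert (0 < eps * (b - a)) by (apply Rmult_lt_0_compat; lra).
  lra.
Qed.

Theorem theorem2p3 (a b c d : R) (hab : a < b) (hcd : c < d)
  (G : R -> R) (hG : ex_RInt G c d) :
  (forall f : R -> R,
     (forall x : R, Icc a b x -> Icc c d (f x)) ->
     ex_RInt f a b ->
     ex_RInt (fun x : R => G (f x)) a b)
  <-> continuous_on (Icc c d) G.
Proof.
  split.
  - intros Hcomp x0 Hx0.
    apply NNPP; intro Hdisc.
    destruct (discontinuity_sequence _ _ _ Hdisc) as [eps [xs [Hlim Hxs]]].
    assert (Hchoice : forall t, exists y,
      (exists n, enum_dyadic n = t /\ y = xs n)
      \/ ((forall n, enum_dyadic n <> t) /\ y = x0)).
    { intro t; destruct (classic (exists n, enum_dyadic n = t)) as [[n Hn]|Hn].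
      - exists (xs n); left; now exists n.
      - exists x0; right; split; [|reflexivity].
        intros n Hnt; apply Hn; now exists n. }
    destruct (functional_choice _ Hchoice) as [f Hf].
    apply (not_ex_RInt_comp_thomae enum_dyadic xs x0 f G a b eps); auto.
    + apply cond_pos.
    + apply dense_dyadic.
    + apply dense_not_dyadic.
    + intro n; apply Hxs.
    + apply Hcomp.
      * intros t _; destruct (Hf t) as [[n [_ ->]]|[_ ->]]; [apply Hxs | exact Hx0].
      * apply (ex_RInt_thomae enum_dyadic xs x0); auto; lra.
  - intros HG f Hrange Hf.
    apply ex_RInt_ext with (fun x => G (clamp c d (f x))).
    + rewrite Rmin_left, Rmax_right by lra; intros x Hx.
      rewrite clamp_id; [reflexivity|]; apply Hrange; unfold Icc; lra.
    + apply (ex_RInt_comp_almost_lipschitz (fun y => G (clamp c d y))); auto.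
      apply continuous_on_clamp_almost_lipschitz; [lra | exact HG].
Qed.
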